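(* Real's cup-$i$ construction $\triangle^{\mathrm R}$ agrees with the canonical cup-$i$ construction $\triangle^{\mathrm{cn}}$; that is, $\triangle^{\mathrm R}_i[n]=\triangle^{\mathrm{cn}}_i[n]$ for all $i,n\in\mathbb{N}$.
   Context: For a finite set $\{0,\dots,n\}$, a basis element $V\otimes V'$, with $V,V'\subsetneq\{0,\dots,n\}$, stands for the tensor product $d_V[n]\otimes d_{V'}[n]$ in $N(\Delta^n)^{\otimes2}$, where $N(\Delta^n)$ is the chain complex over $\mathbb{F}_2$ with basis the faces of the standard $n$-simplex and $d_V[n]$ is the face with vertex set $\{0,\dots,n\}\setminus V$. A semi-simplicial cup-$i$ construction is encoded by elements $\triangle_i[n]\in N(\Delta^n)^{\otimes2}_{n+i}$, $i,n\in\mathbb{N}$, such that the induced maps $\triangle_i\colon N(\Delta^n)\to N(\Delta^n)^{\otimes 2}$, natural with respect to coface maps, satisfy $\partial\triangle_i+\triangle_i\partial=(1+T)\triangle_{i-1}$, where $T$ is transposition and $\triangle_{-1}=0$. **Canonical construction.** For $U=\{u_1<\dots<u_{n-i}\}\subseteq\{0,\dots,n\}$ and $\varepsilon\in\{0,1\}$ let $U^\varepsilon=\{u_j\in U: u_j+j\equiv \varepsilon\bmod 2\}$. Then $\triangle^{\mathrm{cn}}_i[n]=\sum_{|U|=n-i}U^0\otimes U^1$ for $0\le i\le n$ and $\triangle^{\mathrm{cn}}_i[n]=0$ for $i>n$. **Real's construction.** It is defined by $\triangle^{\mathrm R}_i=\mathrm{AW}\,(T\,\mathrm{SHI})^i$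 from the Alexander–Whitney map $\mathrm{AW}$, the Eilenberg–Zilber map $\mathrm{EZ}$ and an explicit natural chain homotopy $\mathrm{SHI}$ between $\mathrm{EZ}\,\mathrm{AW}$ and the identity; in terms of faces it is given (González-Díaz–Real) by the following formulas, which may be taken as its definition. If $i>n$ then $\triangle_i^{\mathrm R}[n]=0$. Otherwise $\triangle_i^{\mathrm R}[n]$ is the sum over all integers $0\le j_0<j_1<\dots<j_i\le n$ of $$\{j_0+1,\dots,j_1-1\}\cup\{j_2+1,\dots,j_3-1\}\cup\dots\cup\{j_i+1,\dots,n\}\ \otimes\ \{0,\dots,j_0-1\}\cup\{j_1+1,\dots,j_2-1\}\cup\dots\cup\{j_{i-1}+1,\dots,j_i-1\}$$ if $i$ is even, and of $$\{j_0+1,\dots,j_1-1\}\cup\{j_2+1,\dots,j_3-1\}\cup\dots\cup\{j_{i-1}+1,\dots,j_i-1\}\ \otimes\ \{0,\dots,j_0-1\}\cup\{j_1+1,\dots,j_2-1\}\cup\dots\cup\{j_i+1,\dots,n\}$$ if $i$ is odd. (Intervals $\{a,\dots,b\}$ with $a>b$ are empty.) *)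

(* Defs.v *)
From HB Require Import structures.
From mathcomp Require Import all_boot all_order all_algebra.

Set Implicit Arguments.
Unset Strict Implicit.
Unset Printing Implicit Defensive.

Import GRing.Theory.
Local Open Scope ring_scope.

(* Faces of the standard n-simplex, given by their nonempty vertex sets. *)
Definition face (n : nat) := {F : {set 'I_n.+1} | F != set0}.

(* The underlying F_2-vector spaces of N(Delta^n) and of N(Delta^n) (x)
   N(Delta^n): coordinate functions on the basis of faces, resp. of pairs of
   faces. The total spaces are used, so the degree is not part of the type. *)
Definition chain (n : nat) := {ffun face n -> 'F_2}.
Definition chain2 (n : nat) := {ffun face n * face n -> 'F_2}.

Definition tensor (n : nat) (x y : chain n) : chain2 n :=
  [ffun p => x p.1 * y p.2].

(* d_V[n], the basis element of the face with vertex set {0,...,n} \ V. It only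
   denotes a face for V a proper subset; for V = {0,...,n} it is 0. *)
Definition dface (n : nat) (V : {set 'I_n.+1}) : chain n :=
  [ffun F => (val F == ~: V)%:R].

Definition basis2 (n : nat) (V V' : {set 'I_n.+1}) : chain2 n :=
  tensor (dface V) (dface V').

(* The 1-based position of u in the increasing enumeration of U, i.e. the j
   such that u = u_j, when u \in U. *)
Definition position (n : nat) (U : {set 'I_n.+1}) (u : 'I_n.+1) : nat :=
  #|[set v in U | (v <= u)%N]|.

Definition parity_part (n : nat) (eps : bool) (U : {set 'I_n.+1}) :
    {set 'I_n.+1} :=
  [set u in U | u + position U u == eps %[mod 2]]%N.

Definition cup_cn (i n : nat) : chain2 n :=
  if (i <= n)%N then
    \sum_(U : {set 'I_n.+1} | #|U| == (n - i)%N)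
       basis2 (parity_part false U) (parity_part true U)
  else 0.

(* Half-open, [a, b): the interval {a,...,b-1} of the usual formulas, avoiding
   the truncated predecessor of b = 0. *)
Definition interval (n a b : nat) : {set 'I_n.+1} :=
  [set x : 'I_n.+1 | (a <= x < b)%N].

(* For s = [:: j_0; ...; j_i], the interval {j_k + 1,...,j_{k+1} - 1}. *)
Definition gap (n : nat) (s : seq nat) (k : nat) : {set 'I_n.+1} :=
  interval n (nth 0%N s k).+1 (nth 0%N s k.+1).

(* The intervals {0,...,j_0 - 1} and {j_i + 1,...,n}. *)
Definition initial_gap (n : nat) (s : seq nat) : {set 'I_n.+1} :=
  interval n 0 (nth 0%N s 0).
Definition final_gap (n i : nat) (s : seq nat) : {set 'I_n.+1} :=
  interval n (nth 0%N s i).+1 n.+1.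

(* The summand of Real's formula at s = [:: j_0; ...; j_i]. With m = i./2, the
   index i is m.*2 in the even case and m.*2.+1 in the odd case. *)
Definition real_term (i n : nat) (s : seq nat) : chain2 n :=
  let m := i./2 in
  if odd i then
    basis2 (\bigcup_(k < m.+1) gap n s k.*2)
           (initial_gap n s :|: (\bigcup_(k < m) gap n s k.*2.+1)
              :|: final_gap n i s)
  else
    basis2 ((\bigcup_(k < m) gap n s k.*2) :|: final_gap n i s)
           (initial_gap n s :|: \bigcup_(k < m) gap n s k.*2.+1).

Definition cup_real (i n : nat) : chain2 n :=
  if (i <= n)%N then
    \sum_(j : i.+1.-tuple 'I_n.+1 | sorted ltn (map val j))
       real_term i n (map val j)
  else 0.

(* Main.v *)
Require Import Defs.
From mathcomp Require Import all_boot all_order all_algebra.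
From mathcomp Require Import zify.

Set Implicit Arguments.
Unset Strict Implicit.
Unset Printing Implicit Defensive.

(** The complement of [J = {j_0 < ... < j_i}] runs over the subsets [U] of
    cardinality [n - i]. If [u] lies in [U] and [r] elements of [J] lie below
    [u], then the position of [u] in [U] is [u + 1 - r], so that [u] plus its
    position has the parity of [r + 1]. Hence [U^0] and [U^1] consist of the
    elements of [U] with [r] odd and [r] even, and these are the unions of the
    alternate gaps of [J] which occur in Real's formula. *)

Definition rank (s : seq nat) (x : nat) : nat := count (fun y => y < x) s.

(** Since [s] is increasing, its entries below [x] are exactly its first [rank s x] entries. *)
Lemma nth_lt_rank (s : seq nat) (k x : nat) :
  sorted ltn s -> k < size s -> (nth 0 s k < x) = (k < rank s x).
Proof.
move=> s_inc k_lt; have s_le := sub_sorted (fun a b => @ltnW a b) s_inc.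
have [lt_k|ge_k] := ltnP k (rank s x);
  first exact: (@Order.PreorderTheory.nth_count_lt _ nat x 0 s k s_le lt_k).
apply/negbTE; rewrite -leqNgt.
apply: (@Order.TotalTheory.DualTotalTheory.nth_count_ge _ nat x 0 s k s_le).
by rewrite k_lt andbT.
Qed.

(** The left side negates [nth 0 s k < x.+1], and passing from [x] to [x.+1] raises the rank by one
    precisely when [x] is an entry, entries being distinct. *)
Lemma nth_gt_rank (s : seq nat) (k x : nat) :
  sorted ltn s -> k < size s ->
  (x < nth 0 s k) = (rank s x + (x \in s) <= k).
Proof.
move=> s_inc k_lt; rewrite ltnNge -ltnS nth_lt_rank // -leqNgt.
suff -> : rank s x.+1 = rank s x + (x \in s) by [].
rewrite -count_uniq_mem ?(sorted_uniq ltn_trans ltnn) // /rank.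
rewrite -count_predUI (@eq_count _ (predI _ _) pred0) => [|y /=]; last first.
  by case: eqP => [->|]; rewrite ?ltnn ?andbF.
rewrite count_pred0 addn0; apply: eq_count => y /=.
by rewrite ltnS leq_eqVlt orbC.
Qed.

(** The endpoints say that the rank [r] satisfies [k < r] and [r + (x \in s) <= k.+1]; this rules
    out entries of [s] and pins [r]. *)
Lemma in_gap (n k : nat) (s : seq nat) (x : 'I_n.+1) :
  sorted ltn s -> k.+1 < size s ->
  (x \in gap n s k) = (val x \notin s) && (rank s x == k.+1).
Proof.
move=> s_inc k_lt; rewrite inE nth_lt_rank ?(ltnW k_lt) // nth_gt_rank //=.
by case: (_ \in s) => /=; lia.
Qed.

Lemma in_initial_gap (n : nat) (s : seq nat) (x : 'I_n.+1) :
  sorted ltn s -> 0 < size s ->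
  (x \in initial_gap n s) = (val x \notin s) && (rank s x == 0).
Proof.
move=> s_inc s_gt0; rewrite inE nth_gt_rank //=.
by case: (_ \in s) => /=; lia.
Qed.

Lemma in_final_gap (n i : nat) (s : seq nat) (x : 'I_n.+1) :
  sorted ltn s -> size s = i.+1 ->
  (x \in final_gap n i s) = (val x \notin s) && (rank s x == i.+1).
Proof.
move=> s_inc s_size; rewrite inE ltn_ord andbT.
have := nth_gt_rank x s_inc (k := i); have := nth_lt_rank x s_inc (k := i).
rewrite s_size ltnSn => -> // /(_ isT).
have r_le : rank s x <= i.+1 by rewrite -s_size count_size.
(* No later entry bounds this gap, so entries of [s] are excluded directly: each is some [j_k] with
   [k <= i], hence at most [j_i]. *)
case: (boolP (val x \in s)) => [/(nthP 0) [k] | _ _]; last by lia.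
rewrite s_size ltnS => k_le <- _ /=; apply/negbTE.
rewrite -nth_lt_rank ?s_size // -leqNgt.
have s_le := sub_sorted (fun a b => @ltnW a b) s_inc.
by apply: (sorted_leq_nth leq_trans leqnn 0 s_le); rewrite ?inE ?s_size.
Qed.

Lemma in_alternate_gaps (n m : nat) (b : bool) (s : seq nat) (x : 'I_n.+1) :
  sorted ltn s -> b + m.*2 <= size s ->
  (x \in \bigcup_(k < m) gap n s (b + k.*2)) =
    [&& val x \notin s, odd (rank s x) == ~~ b, b < rank s x
      & rank s x <= b + m.*2].
Proof.
move=> s_inc s_size; apply/bigcupP/idP => [[k _]|].
  have k_lt := ltn_ord k.
  rewrite in_gap //; last by case: b s_size => /=; lia.
  by case: (_ \in s) => //= /eqP ->; case: b s_size; lia.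
move=> /and4P [x_s r_odd r_gt r_le].
(* The index solves [rank s x = b + k.*2 + 1], the rank on the gap numbered [b + k.*2]. *)
have k_lt : (rank s x - b.+1)./2 < m by case: b {s_size} r_odd r_gt r_le; lia.
exists (Ordinal k_lt) => //=.
rewrite in_gap ?x_s //=; last by case: b s_size r_odd r_gt r_le k_lt; lia.
by case: b {s_size k_lt} r_odd r_gt r_le; lia.
Qed.

(** The final gap has rank [i.+1], so the parity of [i] decides which factor receives it; the
    initial gap has rank 0 and always goes to the right. *)
Lemma real_termE (i n : nat) (s : seq nat) :
  sorted ltn s -> size s = i.+1 ->
  real_term i n s =
    basis2 [set x : 'I_n.+1 | (val x \notin s) && odd (rank s x)]
           [set x : 'I_n.+1 | (val x \notin s) && ~~ odd (rank s x)].
Proof.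
move=> s_inc s_size; rewrite /real_term.
have even_gaps m x := @in_alternate_gaps n m false s x s_inc.
have odd_gaps m x := @in_alternate_gaps n m true s x s_inc.
have r_le (x : 'I_n.+1) : rank s x <= i.+1 by rewrite -s_size count_size.
case: ifP => i_odd; congr basis2; apply/setP => x;
  rewrite ?in_setU ?in_initial_gap ?in_final_gap ?even_gaps ?odd_gaps;
  rewrite ?s_size //;
  try lia; rewrite inE;
  have := r_le x; case: (_ \in s) => //=; lia.
Qed.

Lemma rank_card (n m : nat) (t : m.-tuple 'I_n) (x : nat) :
  uniq t -> rank (map val t) x = #|[set y in t | val y < x]|.
Proof.
move=> t_uniq; rewrite /rank count_map -size_filter.
rewrite -(card_uniqP (filter_uniq _ t_uniq)).
by apply: eq_card => y; rewrite !inE mem_filter andbC.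
Qed.

Lemma card_le_ord (n : nat) (x : 'I_n) : #|[set y : 'I_n | y <= x]| = x.+1.
Proof.
case: x => x x_lt; rewrite cardE /enum_mem -enumT size_filter.
rewrite (eq_count (a2 := preim val (fun y => y <= x))); last first.
  by move=> y; rewrite /= !inE.
rewrite -count_map val_enum_ord /= -(@subnKC x.+1 n) // iotaD count_cat.
rewrite (eq_in_count (a2 := predT)) ?count_predT ?size_iota; last first.
  by move=> y; rewrite mem_iota add0n ltnS => /andP [_ ->].
rewrite [X in _ + X](eq_in_count (a2 := pred0)) ?count_pred0 ?addn0 //.
by move=> y; rewrite mem_iota add0n => /andP [+ _]; rewrite ltnNge => /negbTE.
Qed.

(** The [x.+1] vertices up to [x] split into those outside [t], counted by the position, and those
    in [t], which lie strictly below [x] because [x] is not in [t]. *)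
Lemma position_compl (n m : nat) (t : m.-tuple 'I_n.+1) (x : 'I_n.+1) :
  uniq t -> x \notin t ->
  position (~: [set y in t]) x + rank (map val t) x = x.+1.
Proof.
move=> t_uniq x_t; rewrite -card_le_ord rank_card // /position.
rewrite -(cardsID [set y in t] [set y : 'I_n.+1 | y <= x]) addnC.
congr (_ + _); apply: eq_card => y; rewrite !inE //.
rewrite [RHS]andbC; case: (boolP (y \in t)) => //= y_t.
by rewrite [RHS]leq_eqVlt; case: eqP y_t x_t => // /ord_inj -> ->.
Qed.

Lemma parity_part_compl (n m : nat) (eps : bool) (t : m.-tuple 'I_n.+1) :
  uniq t ->
  parity_part eps (~: [set y in t]) =
    [set x : 'I_n.+1 | (val x \notin map val t)
                    && (odd (rank (map val t) x) == ~~ eps)].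
Proof.
move=> t_uniq; apply/setP => x; rewrite !inE mem_map; last exact: val_inj.
case: (boolP (x \in t)) => //= x_t.
by have /= := position_compl t_uniq x_t; case: eps; lia.
Qed.

Lemma sum_sorted_tuples (V : nmodType) (n m : nat) (F : {set 'I_n.+1} -> V) :
  (\sum_(A : {set 'I_n.+1} | #|A| == m) F A =
   \sum_(t : m.-tuple 'I_n.+1 | sorted ltn (map val t)) F [set x in t])%R.
Proof.
(* The inverse enumerates [A]. Using [mkseq] forces length [m] for every [A]; the default [ord0]
   never shows when [A] has [m] elements. *)
pose f_A (A : {set 'I_n.+1}) := [tuple of mkseq (nth ord0 (enum A)) m].
have val_fA (A : {set 'I_n.+1}) : #|A| = m -> val (f_A A) = enum A.
  by move=> Am; rewrite -[enum _](mkseq_nth ord0) -cardE Am.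
have inc_A (A : {set 'I_n.+1}) : sorted ltn (map val (enum A)).
  have sub : subseq (map val (enum A)) (map val (enum 'I_n.+1)).
    by apply: map_subseq; rewrite enumT; apply: filter_subseq.
  by apply: (subseq_sorted ltn_trans sub); rewrite val_enum_ord iota_ltn_sorted.
rewrite (reindex_onto (fun t : m.-tuple _ => [set x in t]) f_A) /=; last first.
  by move=> A /eqP cardA; apply/setP => x; rewrite inE -(mem_enum A) -val_fA.
apply: eq_bigl => t; apply/andP/idP => [[/eqP t_m /eqP <-]|inc_t].
  by rewrite val_fA.
have t_m : #|[set x in t]| = m.
  rewrite cardsE (card_uniqP _) ?size_tuple // -(map_inj_uniq val_inj).
  exact: sorted_uniq ltn_trans ltnn _ inc_t.
rewrite t_m; split=> //; rewrite -val_eqE val_fA //; apply/eqP.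
(* Strictly increasing sequences with the same members coincide. *)
apply: (inj_map val_inj); apply: (irr_sorted_eq ltn_trans ltnn) => // y.
by apply/mapP/mapP => -[x x_t ->]; exists x; rewrite // mem_enum inE in x_t *.
Qed.

Theorem mainTheorem4 : forall i n : nat, cup_real i n = cup_cn i n.
Proof.
move=> i n; rewrite /cup_real /cup_cn; case: ifP => // i_le.
(* Sum over the complement [J] of [U] instead; it has [i.+1] elements because [i <= n]. *)
rewrite [RHS](reindex_inj (@setC_inj _)) /=.
rewrite [RHS](eq_bigl (fun A : {set 'I_n.+1} => #|A| == i.+1)); last first.
  move=> A; have := cardsC A; rewrite card_ord.
  by move: #|A| #|~: A| => a b /=; lia.
rewrite sum_sorted_tuples; apply: eq_bigr => t t_inc.
have t_uniq : uniq t.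
  by rewrite -(map_inj_uniq val_inj) (sorted_uniq ltn_trans ltnn).
rewrite real_termE ?size_map ?size_tuple // !parity_part_compl //.
by congr basis2; apply/setP => x; rewrite !inE; case: (odd _).
Qed.
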